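(* Let $\Pi$ be a glueable abstract pattern space over $(X,\Gamma)$ and let $\Sigma$ be a supremum-closed, atomistic subshift of $\Pi$ with the limit inclusion property. Let $\mathcal{P}\in\Sigma$ and assume that the set $A(\mathcal{P}\wedge K)$ is finite for each $K\in\mathrm{Cpt}(X)$. If the continuous hull $X_{\mathcal{P}}$ is compact, then the abstract pattern $\mathcal{P}$ has finite local complexity (FLC).
   Context: Setting. $X$ is a nonempty proper metric space (closed balls are compact); $B(x,r)$ denotes the closed ball. $\Gamma$ is a group with a left-invariant proper metric $\rho_\Gamma$, and $\Gamma$ is a topological group for the metric topology. $\Gamma$ acts on $X$ by isometries and the action map $\Gamma\times X\to X$ is (jointly) continuous. $\mathrm{Cl}(X)$ is the set of closed subsets of $X$, $\mathrm{Cpt}(X)$ the set of compact subsets of $X$, and $\mathscr{V}$ the set of compact neighborhoods of the identity $e\in\Gamma$. Abstract pattern spaces. An abstract pattern space over $X$ is a nonempty set $\Pi$ with a map (cutting-off operation) $\Pi\times \mathrm{Cl}(X)\to\Pi$, $(\mathcal{P},C)\mapsto\mathcal{P}\wedge C$, such that (1) $(\mathcal{P}\wedge C_1)\wedge C_2=\mathcal{P}\wedge(C_1\cap C_2)$ for all $\mathcal{P}\in\Pi$ and $C_1,C_2\in\mathrm{Cl}(X)$; (2) for every $\mathcal{P}\in\Pi$ there is a (necessarily unique) closed set, denoted $\operatorname{supp}\mathcal{P}$, such that for all $C\in\mathrm{Cl}(X)$: $\mathcal{P}\wedge C=\mathcal{P}\iff C\supset\operatorname{supp}\mathcal{P}$.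 It is an abstract pattern space over $(X,\Gamma)$ if moreover $\Gamma$ acts on $\Pi$ and $(\gamma\mathcal{P})\wedge(\gamma C)=\gamma(\mathcal{P}\wedge C)$ for all $\mathcal{P}\in\Pi$, $C\in\mathrm{Cl}(X)$, $\gamma\in\Gamma$. Elements of $\Pi$ are called abstract patterns. A subshift of $\Pi$ is a nonempty subset $\Sigma\subset\Pi$ with $\gamma\mathcal{P}\in\Sigma$ whenever $\mathcal{P}\in\Sigma$, $\gamma\in\Gamma$. Order and gluing. $\mathcal{P}\geq\mathcal{Q}$ means $\mathcal{P}\wedge\operatorname{supp}\mathcal{Q}=\mathcal{Q}$; this is a partial order on $\Pi$. $\bigvee\Xi$ denotes the supremum of $\Xi\subset\Pi$ for this order, when it exists. Two elements $\mathcal{P},\mathcal{Q}\in\Pi$ are compatible if some $\mathcal{R}\in\Pi$ satisfies $\mathcal{R}\geq\mathcal{P}$ and $\mathcal{R}\geq\mathcal{Q}$. A subset $\Xi\subset\Pi$ is pairwise compatible if any two elements of $\Xi$ are compatible. For $C\in\mathrm{Cl}(X)$ put $\Xi\wedge C=\{\mathcal{P}\wedge C\mid\mathcal{P}\in\Xi\}$. $\Xi$ is locally finite if $\Xi\wedge B(x,r)$ is finite for all $x\in X$, $r>0$. $\Pi$ is glueable if for every locally finite and pairwise compatible $\Xi\subset\Pi$ (including $\Xi=\emptyset$) the supremum $\bigvee\Xi$ exists in $\Pi$ and $\bigvee(\Xi\wedge C)=(\bigvee\Xi)\wedge C$ for all $C\in\mathrm{Cl}(X)$. A subshift $\Sigma$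 of a glueable $\Pi$ is supremum-closed if $\bigvee\Xi\in\Sigma$ for every locally finite and pairwise compatible $\Xi\subset\Sigma$. A zero element is an element with empty support; a glueable $\Pi$ has exactly one, denoted $0$. Atoms. $\mathcal{P}\in\Pi$ is an atom if $\operatorname{supp}\mathcal{P}$ is compact and, for $\mathcal{Q}\in\Pi$, $\mathcal{Q}\leq\mathcal{P}$ implies $\mathcal{Q}=\mathcal{P}$ or $\mathcal{Q}=0$. Put $A(\mathcal{P})=\{\mathcal{Q}\text{ atom}\mid\mathcal{Q}\leq\mathcal{P}\}$. A subset $\Sigma\subset\Pi$ is atomistic if for every $\mathcal{P}\in\Sigma$ the supremum $\bigvee A(\mathcal{P})$ exists and equals $\mathcal{P}$. $\Sigma$ has the limit inclusion property if for every $\mathcal{P}\in\Sigma$ and every atom $\mathcal{Q}\in\Pi$: if for each $V\in\mathscr{V}$ there is $\gamma_V\in V$ with $\gamma_V\mathcal{Q}\leq\mathcal{P}$, then $\mathcal{Q}\leq\mathcal{P}$. Local matching structure. For $K\in\mathrm{Cpt}(X)$ and $V\in\mathscr{V}$ let $\mathcal{U}_{K,V}=\{(\mathcal{P},\mathcal{Q})\in\Pi\times\Pi\mid\exists\gamma\in V:\ \mathcal{P}\wedge K=(\gamma\mathcal{Q})\wedge K\}$. These sets form a fundamental system of entourages of a uniform structure on $\Pi$, the local matching uniform structure; the induced topology is the local matching topology. Hull and FLC. The continuous hull of $\mathcal{P}\in\Pi$ is $X_{\mathcal{P}}=\overline{\{\gamma\mathcal{P}\mid\gamma\in\Gamma\}}$,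 the closure being taken in $\Pi$ with respect to the local matching topology. $\mathcal{P}$ has finite local complexity (FLC) if for every compact $K\subset X$ the set $\{(\gamma\mathcal{P})\wedge K\mid\gamma\in\Gamma\}$ is finite modulo the action of $\Gamma$ on $\Pi$, i.e. its elements lie in finitely many $\Gamma$-orbits. *)

(* Defs.v *)
From HB Require Import structures.
From mathcomp Require Import all_boot all_order all_algebra.
From mathcomp Require Import all_classical all_reals.
From mathcomp Require Import topology.

Set Implicit Arguments.
Unset Strict Implicit.
Unset Printing Implicit Defensive.

Import Order.TTheory GRing.Theory Num.Theory.

Local Open Scope classical_set_scope.

(* The library's [closed_ball] is the closure of an open ball, which may be
   smaller than the set of points at distance at most r. *)
Definition cball (R : realType) (X : metricType R) (x : X) (r : R) : set X :=
  [set y | (mdist x y <= r)%R].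

HB.mixin Record Metric_isProper (R : realType) X & Metric R X := {
  compact_cball : forall (x : X) (r : R), compact (cball x r)
}.

#[short(type="properMetricType")]
HB.structure Definition ProperMetric (R : realType) :=
  {X of Metric R X & Metric_isProper R X}.

HB.mixin Record GroupMetric_isLeftInvariant (R : realType) G
    & Group G & Metric R G := {
  mdist_mulgl : forall g x y : G, mdist (g * x)%g (g * y)%g = mdist x y;
  mulg_continuous : continuous (fun p : G * G => (p.1 * p.2)%g);
  invg_continuous : continuous (fun g : G => (g^-1)%g)
}.

#[short(type="properMetricGroupType")]
HB.structure Definition ProperMetricGroup (R : realType) :=
  {G of Group G & ProperMetric R G & GroupMetric_isLeftInvariant R G}.

Record is_left_action (G : groupType) (T : Type) (act : G -> T -> T) : Prop := {
  left_act1 : forall x, act 1%g x = x;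
  left_actM : forall g h x, act (g * h)%g x = act g (act h x)
}.

Record isometric_action (R : realType) (G : properMetricGroupType R)
    (X : properMetricType R) := IsometricAction {
  iact :> G -> X -> X;
  iact_action : is_left_action iact;
  iact_isometry : forall g x y, mdist (iact g x) (iact g y) = mdist x y;
  iact_continuous : continuous (fun p : G * X => iact p.1 p.2)
}.

(* The cutting-off operation is a total function on [set X], but only its
   values at closed sets are ever constrained or used. *)
Record pattern_space (R : realType) (X : properMetricType R) := PatternSpace {
  pattern :> Type;
  pattern_inhabited : inhabited pattern;
  cut : pattern -> set X -> pattern;
  supp : pattern -> set X;
  cut_cut : forall P C1 C2, closed C1 -> closed C2 ->
    cut (cut P C1) C2 = cut P (C1 `&` C2);
  closed_supp : forall P, closed (supp P);
  cut_suppP : forall P C, closed C -> (cut P C = P <-> supp P `<=` C)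
}.

Arguments closed_supp {R X p} P.

Record gpattern_space (R : realType) (G : properMetricGroupType R)
    (X : properMetricType R) (a : isometric_action G X) := GPatternSpace {
  gpattern :> pattern_space X;
  pact : G -> gpattern -> gpattern;
  pact_action : is_left_action pact;
  pact_cut : forall g P C, closed C ->
    cut (pact g P) (a g @` C) = pact g (cut P C)
}.

Section pattern_order.
Context (R : realType) (X : properMetricType R) (Pi : pattern_space X).
Implicit Types (P Q S : Pi) (Xi : set Pi) (C : set X).

Definition pattern_le Q P := cut P (supp Q) = Q.

Definition pattern_sup Xi S :=
  (forall P, Xi P -> pattern_le P S) /\
  (forall T, (forall P, Xi P -> pattern_le P T) -> pattern_le S T).

Definition compatible P Q := exists S, pattern_le P S /\ pattern_le Q S.

Definition pairwise_compatible Xi :=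
  forall P Q, Xi P -> Xi Q -> compatible P Q.

Definition cut_set Xi C : set Pi := [set cut P C | P in Xi].

Definition locally_finite Xi :=
  forall (x : X) (r : R), (0 < r)%R -> finite_set (cut_set Xi (cball x r)).

Definition glueable := forall Xi,
  locally_finite Xi -> pairwise_compatible Xi ->
  exists2 S, pattern_sup Xi S &
    forall C, closed C -> pattern_sup (cut_set Xi C) (cut S C).

Definition is_zero P := supp P = set0.

Definition atom P :=
  compact (supp P) /\ forall Q, pattern_le Q P -> Q = P \/ is_zero Q.

Definition atoms_below P : set Pi := [set Q | atom Q /\ pattern_le Q P].

Definition atomistic (Sigma : set Pi) :=
  forall P, Sigma P -> pattern_sup (atoms_below P) P.

Definition supremum_closed (Sigma : set Pi) := forall Xi, Xi `<=` Sigma ->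
  locally_finite Xi -> pairwise_compatible Xi ->
  forall S, pattern_sup Xi S -> Sigma S.

Lemma pattern_le_refl P : pattern_le P P.
Proof. by apply/(cut_suppP P (closed_supp P)). Qed.

Lemma pattern_le_supp P Q : pattern_le Q P -> supp Q `<=` supp P.
Proof.
move=> QP; apply/(cut_suppP Q (closed_supp P)).
rewrite -{1}QP cut_cut; [|exact: closed_supp..].
rewrite setIC -cut_cut; [|exact: closed_supp..].
by rewrite pattern_le_refl QP.
Qed.

Lemma pattern_le_anti P Q : pattern_le P Q -> pattern_le Q P -> P = Q.
Proof.
move=> PQ QP; rewrite -[LHS](pattern_le_refl P) -[RHS]QP.
by congr cut; apply/seteqP; split; exact: pattern_le_supp.
Qed.

Lemma pattern_le_trans P Q S :
  pattern_le P Q -> pattern_le Q S -> pattern_le P S.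
Proof.
move=> PQ QS; rewrite /pattern_le -{2}PQ -QS cut_cut; [|exact: closed_supp..].
by congr cut; rewrite setIC; apply/esym/setIidPl; exact: pattern_le_supp.
Qed.

Lemma pattern_sup_unique Xi S T : pattern_sup Xi S -> pattern_sup Xi T -> S = T.
Proof. by move=> [S1 S2] [T1 T2]; apply: pattern_le_anti; auto. Qed.

(* Hence, in a glueable space, [is_zero Q] in [atom] means Q = 0. *)
Lemma glueable_zero : glueable -> exists! Z, is_zero Z.
Proof.
move=> /(_ set0)[x r _||Z [_ Zmin] Zcut].
- by rewrite /cut_set image_set0; exact: finite_set0.
- by move=> P Q [].
have le0 T : pattern_le Z T by apply: Zmin.
have Z0 : is_zero Z.
  have cZ : closed (set0 : set X) by exact: closed0.
  have [_ /(_ Z)] := Zcut _ cZ.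
  rewrite /cut_set image_set0 => /(_ (fun _ => False_ind _)) /pattern_le_supp ZZ.
  have := le0 (cut Z set0) => ZcZ.
  have cZE : cut Z set0 = Z.
    by apply: pattern_le_anti => //; apply: (Zcut _ cZ).2 => P [Q []].
  by apply/seteqP; split => //; exact/(cut_suppP Z cZ).
exists Z; split => // T T0; have := le0 T; rewrite /pattern_le Z0 -T0.
by rewrite pattern_le_refl.
Qed.

End pattern_order.

Section equivariant_patterns.
Context (R : realType) (G : properMetricGroupType R) (X : properMetricType R).
Context (a : isometric_action G X) (Pi : gpattern_space a).
Implicit Types (P Q : Pi) (Sigma : set Pi) (K : set X) (V : set G).

Definition subshift Sigma :=
  Sigma !=set0 /\ forall g P, Sigma P -> Sigma (pact g P).

Definition compact_nbhs1 V := nbhs (1%g : G) V /\ compact V.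

Definition limit_inclusion Sigma := forall P Q, Sigma P -> atom Q ->
  (forall V, compact_nbhs1 V -> exists2 g, V g & pattern_le (pact g Q) P) ->
  pattern_le Q P.

Definition orbit P : set Pi := [set pact g P | g in [set: G]].

Definition flc P := forall K, compact K ->
  finite_set [set orbit Q | Q in cut_set (orbit P) K].

Definition matching_rel K V : set (Pi * Pi) :=
  [set PQ | exists2 g, V g & cut PQ.1 K = cut (pact g PQ.2) K].

Definition matching_entourage : set_system (Pi * Pi) :=
  filter_from [set KV : set X * set G | compact KV.1 /\ compact_nbhs1 KV.2]
    (fun KV => matching_rel KV.1 KV.2).

Lemma compact_closed_metric (T : metricType R) (A : set T) :
  compact A -> closed A.
Proof. by apply: compact_closed; exact: metric_hausdorff. Qed.

Lemma compact_nbhs1_cball (r : R) : (0 < r)%R -> compact_nbhs1 (cball (1%g : G) r).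
Proof.
move=> r0; split; last exact: compact_cball.
apply: filterS (nbhsx_ballx (1%g : G) r r0) => y.
by rewrite ballEmdist /cball /= => /ltW.
Qed.

Definition set_act V K : set X := [set a p.1 p.2 | p in V `*` K].

Lemma compact_set_act V K : compact V -> compact K -> compact (set_act V K).
Proof.
move=> cV cK; apply: continuous_compact; last exact: compact_setX.
by apply: continuous_subspaceT; exact: iact_continuous.
Qed.

Lemma compact_invg V : compact V -> compact [set (g^-1)%g | g in V].
Proof.
move=> cV; apply: continuous_compact => //.
by apply: continuous_subspaceT; exact: invg_continuous.
Qed.

Lemma iactK g (x : X) : a g (a (g^-1)%g x) = x.
Proof.
by rewrite -(left_actM (iact_action a)) mulgV (left_act1 (iact_action a)).
Qed.

Lemma iactVK g (x : X) : a (g^-1)%g (a g x) = x.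
Proof.
by rewrite -(left_actM (iact_action a)) mulVg (left_act1 (iact_action a)).
Qed.

Lemma pactVK g P : pact (g^-1)%g (pact g P) = P.
Proof.
by rewrite -(left_actM (pact_action Pi)) mulVg (left_act1 (pact_action Pi)).
Qed.

Lemma cut_eq_sub P Q (C D : set X) : closed C -> closed D -> C `<=` D ->
  cut P D = cut Q D -> cut P C = cut Q C.
Proof.
move=> cC cD CD PQ; have -> : C = D `&` C by rewrite setIC; exact/esym/setIidPl.
by rewrite -!cut_cut // PQ.
Qed.

Lemma cut_eq_act g P Q (K L : set X) : compact K -> closed L ->
  (forall x, K x -> L (a (g^-1)%g x)) -> cut P L = cut Q L ->
  cut (pact g P) K = cut (pact g Q) K.
Proof.
move=> cK cL KL PQ; have clK := compact_closed_metric cK.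
pose M := [set a (g^-1)%g x | x in K].
have MM : a g @` M = K.
  apply/seteqP; split => [_ [_ [x Kx <-] <-]|x Kx]; first by rewrite iactK.
  by exists (a (g^-1)%g x); [exists x|rewrite iactK].
have cM : closed M.
  have -> : M = set_act [set (g^-1)%g] K.
    apply/seteqP; split => [_ [x Kx <-]|_ [[h x] [/= -> Kx] <-]].
      by exists ((g^-1)%g, x).
    by exists x.
  by apply: compact_closed_metric; apply: compact_set_act => //; apply: compact_set1.
rewrite -MM !pact_cut //; congr pact.
by apply: cut_eq_sub PQ => // _ [x Kx <-]; exact: KL.
Qed.

Lemma matching_entourage_filter : Filter matching_entourage.
Proof.
apply: filter_from_filter.
  exists (set0, cball (1%g : G) 1); split => /=; first exact: compact0.
  exact: compact_nbhs1_cball.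
move=> [K1 V1] [K2 V2] [/= cK1 [nV1 cV1]] [/= cK2 [nV2 cV2]].
exists (K1 `|` K2, V1 `&` V2).
  split; first exact: compactU.
  split; first exact: filterI.
  apply: (subclosed_compact _ cV1) => [|h []//].
  by apply: closedI; apply: compact_closed_metric.
move=> [P Q] [g [/= V1g V2g] PQ].
have cl1 := compact_closed_metric cK1; have cl2 := compact_closed_metric cK2.
by split; exists g => //=; apply: cut_eq_sub PQ => //; exact: closedU.
Qed.

Lemma matching_entourage_diagonal E : matching_entourage E -> diagonal `<=` E.
Proof.
move=> [[K V] [_ [nV _]] KVE] [P Q] PQ.
have {PQ} <- : P = Q by exact: PQ.
apply: KVE; exists 1%g => /=.
  exact: nbhs_singleton nV.
by rewrite (left_act1 (pact_action Pi)).
Qed.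

Lemma matching_entourage_inv E :
  matching_entourage E -> matching_entourage (E^-1)%relation.
Proof.
move=> [[K V] [/= cK [nV cV]] KVE].
pose W := [set (g^-1)%g | g in V].
exists (set_act W K, W).
  split => /=; first by apply: compact_set_act => //; exact: compact_invg.
  split; last exact: compact_invg.
  have : nbhs (1^-1 : G)%g V by rewrite invg1.
  move=> /(invg_continuous (1%g : G)) nVi.
  suff : nbhs (1%g : G) [set g | V (g^-1)%g].
    by apply: filterS => g Vg; exists (g^-1)%g => //; rewrite invgK.
  exact: nVi.
move=> [P Q] [_ [/= h Vh <-] PQ]; apply: KVE; exists h => //=.
rewrite -[Q in LHS](pactVK (h^-1)%g) invgK; apply: esym.
apply: cut_eq_act PQ => //.
  apply: compact_closed_metric; apply: compact_set_act => //; exact: compact_invg.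
by move=> x Kx; exists ((h^-1)%g, x) => //; split => //; exists h.
Qed.

Lemma matching_entourage_split E : matching_entourage E ->
  exists2 F, matching_entourage F & (F \; F `<=` E)%relation.
Proof.
move=> [[K V] [/= cK [nV cV]] KVE].
have : nbhs ((1 : G) * (1 : G))%g V by rewrite mulg1.
move=> /(@mulg_continuous R G (1%g, 1%g)) [[A B] [/= nA nB] ABV].
have /nbhs_ballP[e /= e0 eAB] : nbhs (1%g : G) (A `&` B) by exact: filterI.
pose W := cball (1%g : G) (e / 2)%R.
have nW : compact_nbhs1 W by apply: compact_nbhs1_cball; rewrite divr_gt0.
have WAB : W `<=` A `&` B.
  apply: subset_trans eAB => y; rewrite /W /cball /= ballEmdist /= => ye.
  by rewrite (le_lt_trans ye) // ltr_pdivrMr // ltr_pMr // ltr1n.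
pose L := K `|` set_act [set (g^-1)%g | g in W] K.
have cL : compact L.
  apply: compactU => //; apply: compact_set_act => //.
  by apply: compact_invg; exact: nW.2.
exists (matching_rel L W); first by exists (L, W).
move=> [P S] [Q [g /= Wg PQ] [h /= Wh QS]]; apply: KVE.
have clK := compact_closed_metric cK; have clL := compact_closed_metric cL.
exists (g * h)%g => /=.
  by apply: (ABV (g, h)); split => /=; [exact: (WAB _ Wg).1|exact: (WAB _ Wh).2].
rewrite (left_actM (pact_action Pi)).
transitivity (cut (pact g Q) K).
  by apply: cut_eq_sub PQ => // x; left.
apply: cut_eq_act QS => // x Kx; right.
by exists ((g^-1)%g, x) => //; split => //; exists g.
Qed.

End equivariant_patterns.

Arguments matching_entourage {R G X a} Pi.

(* An alias of [Pi] carrying the local matching uniform structure, whose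
   fundamental system of entourages is [matching_rel K V]. *)
Definition local_matching (R : realType) (G : properMetricGroupType R)
  (X : properMetricType R) (a : isometric_action G X) (Pi : gpattern_space a)
  : Type := Pi.

HB.instance Definition _ (R : realType) (G : properMetricGroupType R)
  (X : properMetricType R) (a : isometric_action G X) (Pi : gpattern_space a) :=
  gen_eqMixin (local_matching Pi).

HB.instance Definition _ (R : realType) (G : properMetricGroupType R)
  (X : properMetricType R) (a : isometric_action G X) (Pi : gpattern_space a) :=
  gen_choiceMixin (local_matching Pi).

HB.instance Definition _ (R : realType) (G : properMetricGroupType R)
  (X : properMetricType R) (a : isometric_action G X) (Pi : gpattern_space a) :=
  @isUniform.Build (local_matching Pi) (matching_entourage Pi)
    (matching_entourage_filter Pi) (@matching_entourage_diagonal R G X a Pi)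
    (@matching_entourage_inv R G X a Pi) (@matching_entourage_split R G X a Pi).

Definition hull (R : realType) (G : properMetricGroupType R)
  (X : properMetricType R) (a : isometric_action G X) (Pi : gpattern_space a)
  (P : Pi) : set (local_matching Pi) :=
  closure (orbit P : set (local_matching Pi)).

(* Main.v *)
(* A compact hull makes the orbit of P totally bounded: for compact K and a
   compact neighborhood V of 1, finitely many translates h_i P are such that
   every (g P) /\ K equals (v h_i P) /\ K for some i and some v in V. The latter
   is a translate of P /\ C with C = (v h_i)^-1 K, which lies in the compact set
   L_i = h_i^-1 V^-1 K. As the atoms below P form a locally finite set, gluing
   gives P /\ C = sup A(P /\ C), so P /\ C is determined by a subset of the
   finite set A(P /\ L_i). *)
From HB Require Import structures.
Require Import Defs.
From mathcomp Require Import all_boot all_order all_algebra.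
From mathcomp Require Import finmap.
From mathcomp Require Import all_classical all_reals.
From mathcomp Require Import topology.

Local Open Scope classical_set_scope.

Set Implicit Arguments.
Unset Strict Implicit.

Lemma finite_set_subsets (T : Type) (A : set T) :
  finite_set A -> finite_set [set B | B `<=` A].
Proof.
(* [T] is given a choice structure, so that [{fset T}] and its finite powerset make sense. *)
elim/Pchoice: T => T in A *; move=> /finite_fsetP[F ->].
apply: (@sub_finite_set _ _ ((fun E : {fset T} => [set` E]) @` [set` fpowerset F])).
  move=> B BF; have finB : finite_set B := sub_finite_set BF (finite_fset F).
  exists (fset_set B); last by rewrite fset_setK.
  rewrite /= fpowersetE; apply/fsubsetP => x.
  by rewrite in_fset_set // inE => /BF.
exact: finite_image.
Qed.

(** The [E]-balls centred at points of [A] itself already have interiors covering the closure, so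
    the finite subcover has its centres in [A]. *)
Lemma compact_closure_entourage (U : uniformType) (A : set U) (E : set (U * U)) :
  compact (closure A) -> entourage E ->
  exists2 F : set U, finite_set F /\ F `<=` A &
    forall x, A x -> exists2 y, F y & E (x, y).
Proof.
move=> cA entE; have [[x0]|U0] := pselect (inhabited U); last first.
  by exists set0 => [|x _]; [split => //; exact: finite_set0|case: U0].
(* [compact_cover] is only available on pointed spaces. *)
pose pU : puniformType := HB.pack U (isPointed.Build U x0).
have {}cA : @cover_compact pU (closure A) by rewrite -compact_cover.
have [|x Ax|F FA AF] := cA U A (fun y => [set z | E (z, y)]°).
- by move=> y _; exact: open_interior.
- have entS : entourage (split_ent E) by exact: entourage_split_ent.
  (* Half an entourage is spent from [x] to a nearby [y] in [A], the other half from a variable [z]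
     to [x]: thus [x] is interior to the ball around [y]. *)
  have [y [Ay /xsectionP Sxy]] := Ax _ (nbhs_entourage x entS).
  exists y => //; rewrite /interior /=.
  apply: filterS (nbhs_entourage x (entourage_inv entS)) => z /xsectionP Szx.
  exact: entourage_split Szx Sxy.
- exists [set` F]; first by split => // y /FA; rewrite inE.
  move=> x Ax; have [y Fy /interior_subset Exy] := AF x (subset_closure Ax).
  by exists y.
Qed.

Section cut_theory.
Context (R : realType) (X : properMetricType R) (Pi : pattern_space X).
Implicit Types (P Q S : Pi) (C : set X).

Lemma pattern_le_cut P C : closed C -> pattern_le (cut P C) P.
Proof.
move=> cC; have sC : supp (cut P C) `<=` C.
  by apply/cut_suppP => //; rewrite cut_cut // setIid.
rewrite /pattern_le -[RHS](pattern_le_refl (cut P C)) cut_cut //.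
  by rewrite setIC; congr cut; apply/esym/setIidPl.
exact: closed_supp.
Qed.

Lemma cut_mono P Q C : closed C ->
  pattern_le Q P -> pattern_le (cut Q C) (cut P C).
Proof.
move=> cC QP; have cS := closed_supp Q.
have -> : cut Q C = cut (cut P C) (supp Q).
  by rewrite -QP !cut_cut // ?QP 1?setIC.
exact: pattern_le_cut.
Qed.

Lemma pattern_le_cut_sub P C D : closed C -> closed D -> C `<=` D ->
  pattern_le (cut P C) (cut P D).
Proof.
move=> cC cD CD; have -> : cut P C = cut (cut P D) C.
  by rewrite cut_cut // setIC; congr cut; apply/esym/setIidPl.
exact: pattern_le_cut.
Qed.

Lemma atoms_belowS P Q : pattern_le P Q -> atoms_below P `<=` atoms_below Q.
Proof. by move=> PQ S [aS SP]; split => //; exact: pattern_le_trans SP PQ. Qed.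

Lemma atom_zero Q : is_zero Q -> atom Q.
Proof.
move=> Q0; split; first by rewrite Q0; exact: compact0.
by move=> S /pattern_le_supp; rewrite Q0 subset0; right.
Qed.

(** By minimality the cut is either [P] or a zero element, and [atom] admits zero elements. *)
Lemma atom_cut P C : closed C -> atom P -> atom (cut P C).
Proof.
move=> cC [cP minP]; have [->|] := minP _ (pattern_le_cut P cC).
  by split.
exact: atom_zero.
Qed.

Lemma cut_atoms_below P C : closed C ->
  cut_set (atoms_below P) C `<=` atoms_below (cut P C).
Proof.
move=> cC _ [Q [aQ QP] <-]; split; first exact: atom_cut.
exact: cut_mono.
Qed.

Context (gl : glueable Pi) (P : Pi) (supP : pattern_sup (atoms_below P) P).
Context (finA : forall K, compact K -> finite_set (atoms_below (cut P K))).

(** The hypothesis [supP] concerns [P] only, and a cut of [P] may leave the subshift. Gluing makes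
    [cut P C] the supremum of the atoms of [P] cut by [C]; these are among the atoms below
    [cut P C], so the larger set has the same supremum. *)
Lemma cut_pattern_sup C : closed C ->
  pattern_sup (atoms_below (cut P C)) (cut P C).
Proof.
move=> cC; have [x r _|Q S [_ QP] [_ SP]|S supS cutS] := @gl (atoms_below P).
- have cB := compact_cball x r.
  apply: sub_finite_set _ (finA cB); apply: cut_atoms_below => //.
  exact: compact_closed_metric.
- by exists P.
have SP : S = P := pattern_sup_unique supS supP.
have [_ minC] := cutS C cC; split => [Q [_ //]|T ubT].
by rewrite -SP; apply: minC => Q /(cut_atoms_below cC)/ubT.
Qed.

Lemma finite_closed_cuts L : compact L ->
  finite_set [set cut P C | C in [set C | closed C /\ C `<=` L]].
Proof.
move=> cL; set A := (X in finite_set X).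
have clL := compact_closed_metric cL.
(* A cut is recovered from its atoms as their supremum, so finiteness may be checked on the sets of
   atoms. *)
have injA : {in A &, injective (@atoms_below _ _ Pi)}.
  move=> Q S /set_mem[C [cC _] <-] /set_mem[D [cD _] <-] eqA.
  have supC := cut_pattern_sup cC; rewrite eqA in supC.
  exact: pattern_sup_unique supC (cut_pattern_sup cD).
rewrite -(eq_finite_set (inj_card_eq injA)).
apply: sub_finite_set _ (finite_set_subsets (finA cL)) => _ [_ [C [cC CL] <-] <-].
exact/atoms_belowS/pattern_le_cut_sub.
Qed.

End cut_theory.

Section orbit_theory.
Context (R : realType) (G : properMetricGroupType R) (X : properMetricType R).
Context (a : isometric_action G X) (Pi : gpattern_space a).
Implicit Types (P : Pi).

Lemma orbit_pact g P : Defs.orbit (pact g P) = Defs.orbit P.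
Proof.
have actM := left_actM (pact_action Pi).
apply/seteqP; split => _ [h _ <-].
  by exists (h * g)%g => //; rewrite actM.
by exists (h * g^-1)%g => //; rewrite actM pactVK.
Qed.

Lemma compact_iact g (K : set X) : compact K -> compact (a g @` K).
Proof.
move=> cK; have -> : a g @` K = set_act a [set g] K.
  apply/seteqP; split => [_ [x Kx <-]|_ [[h x] [/= -> Kx] <-]]; last by exists x.
  by exists (g, x).
by apply: compact_set_act => //; exact: compact_set1.
Qed.

Lemma cut_pact g P (K : set X) : compact K ->
  cut (pact g P) K = pact g (cut P (a g^-1%g @` K)).
Proof.
move=> cK; rewrite -pact_cut.
  congr cut; apply/seteqP; split => [x Kx|_ [_ [x Kx <-] <-]].
    by exists (a g^-1%g x); [exists x|exact: iactK].
  by rewrite iactK.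
by apply: compact_closed_metric; exact: compact_iact.
Qed.

End orbit_theory.

Unset Implicit Arguments.

Theorem theorem3p26 (R : realType) (G : properMetricGroupType R)
    (X : properMetricType R) (X_nonempty : [set: X] !=set0)
    (a : isometric_action G X) (Pi : gpattern_space a)
    (Pi_glueable : glueable Pi)
    (Sigma : set Pi) (Sigma_subshift : subshift Sigma)
    (Sigma_sup : supremum_closed Sigma) (Sigma_atomistic : atomistic Sigma)
    (Sigma_limit : limit_inclusion Sigma)
    (P : Pi) (SigmaP : Sigma P)
    (finite_atoms :
       forall K : set X, compact K -> finite_set (atoms_below (cut P K)))
    (compact_hull : compact (hull P)) :
  flc P.
Proof.
(* The radius is arbitrary; compactness of [V] is what makes the windows [L h] compact. *)
move=> K cK; pose V := cball (1%g : G) 1%R.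
have nV : compact_nbhs1 V by exact: compact_nbhs1_cball.
have entE : @entourage (local_matching Pi) (matching_rel K V).
  by exists (K, V).
have [F [finF FP] PF] := compact_closure_entourage compact_hull entE.
pose W := [set (g^-1)%g | g in V].
have cW : compact W by apply: compact_invg; exact: nV.2.
pose L h := a h^-1%g @` set_act a W K.
have cL h : compact (L h) by apply: compact_iact; exact: compact_set_act.
(* Outside [F] the value 1 is a dummy. *)
have /choice[r rP] : forall Q, exists h, F Q -> pact h P = Q.
  move=> Q; have [/FP[h _ <-]|nFQ] := pselect (F Q); first by exists h.
  by exists 1%g.
pose cuts h := [set cut P C | C in [set C | closed C /\ C `<=` L h]].
apply: (@sub_finite_set _ _
    (@Defs.orbit _ _ _ _ Pi @` \bigcup_(Q in F) cuts (r Q))).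
  move=> _ [_ [_ [g _ <-] <-] <-].
  have [|Q FQ [v /= Vv vQ]] := PF (pact g P); first by exists g.
  have vr : pact v Q = pact (v * r Q)%g P.
    by rewrite (left_actM (pact_action Pi)) rP.
  (* Moving the translation by [v * r Q] from the pattern to the window changes the cut only within
     its orbit. The new window varies with [v] but stays inside [L (r Q)]. *)
  exists (cut P (a (v * r Q)^-1%g @` K)); last first.
    by rewrite vQ vr cut_pact // orbit_pact.
  exists Q => //; exists (a (v * r Q)^-1%g @` K) => //; split.
    by apply: compact_closed_metric; exact: compact_iact.
  move=> _ [x Kx <-]; exists (a v^-1%g x).
    by exists (v^-1%g, x) => //; split => //; exists v.
  by rewrite invgM (left_actM (iact_action a)).
apply: finite_image; apply: bigcup_finite => // Q FQ.
apply: finite_closed_cuts => //; exact: Sigma_atomistic.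
Qed.
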